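(* Let $(X,d)$ be a separable complete metric space, let $(\Omega,\mathsf{F},\mathbb{P})$ be a probability space with a filtration $(\mathsf{F}_n)_{n\in\mathbb{N}}$, and let $F:X\to[0,\infty]$ be measurable such that $\mathrm{zer}F:=\{z\in X\mid F(z)=0\}$ is closed and non-empty. Let $\phi:X\times X\to[0,\infty)$ be a Carath\'eodory distance which is uniformly consistent with a modulus $\theta:[0,\infty)\to[0,\infty)$ that is nondecreasing and convex with $\theta(0)=0$ and $\theta(\varepsilon)>0$ for $\varepsilon>0$. Let $(x_n)$ be an $X$-valued stochastic process adapted to $(\mathsf{F}_n)$ such that: (1) $(x_n)$ is strongly stochastically $\phi$-quasi-Fej\'er monotone w.r.t.\ $\mathrm{zer}F$ and $(\mathsf{F}_n)$ with error sequences $(\zeta_n),(\xi_n)\in\ell^1_+(\mathsf{F}_n)$, where $K>0$ satisfies $\prod_{n=0}^\infty(1+\zeta_n)<K$ almost surely, and $\chi:(0,\infty)\to\mathbb{N}$ satisfies $\sum_{n=\chi(\varepsilon)}^\infty\mathbb{E}[\xi_n]<\varepsilon$ for all $\varepsilon>0$; (2) $\varphi:(0,\infty)\times\mathbb{N}\to(0,\infty)$ is a $\liminf$-bound in mean for $(x_n)$ w.r.t.\ $F$, i.e.\ for all $\varepsilon>0$ and $N\in\mathbb{N}$ there exists $n\in\mathbb{N}$ with $N\le n\le\varphi(\varepsilon,N)$ and $\mathbb{E}[F(x_n)]<\varepsilon$. Finally, let $D$ be a collection of $X$-valued random variables with $x_n\in D$ for all $n$, and let $\tau:(0,\infty)\to(0,\infty)$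 be a modulus of $\phi$-regularity for $F$ in mean w.r.t.\ $D$. Then there is a $\mathrm{zer}F$-valued random variable $x$ such that $d(x_n,x)\to0$ in mean and almost surely, with rates \[\forall\varepsilon>0\ \forall n\ge\rho(\theta(\varepsilon/2))\ \big(\mathbb{E}[d(x_n,x)]<\varepsilon\big)\] and \[\forall\lambda,\varepsilon>0\ \big(\mathbb{P}(\exists n\ge\rho(\lambda\theta(\varepsilon/2))\,(d(x_n,x)\ge\varepsilon))<\lambda\big),\] where $\rho(\varepsilon):=\varphi\big(\tau(\varepsilon/3K),\chi(\varepsilon/3K)\big)$.
   Context: $X$ carries its Borel $\sigma$-algebra. A Carath\'eodory distance is a function $\phi:X\times X\to[0,\infty)$ that is continuous in its left argument and Borel measurable in its right argument. For non-empty $S\subseteq X$, $\mathrm{dist}^\phi_S(x):=\inf_{s\in S}\phi(s,x)$. $\phi$ is uniformly consistent with modulus $\theta$ if for all $\varepsilon>0$ and $x,y\in X$, $\phi(x,y)<\theta(\varepsilon)$ implies $d(x,y)<\varepsilon$. $\ell^1_+(\mathsf{F}_n)$ denotes the set of sequences $(\xi_n)$ of nonnegative random variables with $\xi_n$ $\mathsf{F}_n$-measurable and $\sum_n\xi_n<\infty$ a.s. A process $(x_n)$ adapted to $(\mathsf{F}_n)$ is strongly stochastically $\phi$-quasi-Fej\'er monotone w.r.t.\ $S\subseteq X$ and $(\mathsf{F}_n)$ with error sequences $(\zeta_n),(\xi_n)\in\ell^1_+(\mathsf{F}_n)$ if $\mathbb{E}[\phi(z,x_{n+1})\mid\mathsf{F}_n]\le(1+\zeta_n)\phi(z,x_n)+\xi_n$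 a.s.\ for all $n\in\mathbb{N}$ and all $X$-valued $\mathsf{F}_n$-measurable random variables $z$ with $z\in S$ a.s.\ and $\mathbb{E}[\phi(z,x_n)]<\infty$. A modulus of $\phi$-regularity for $F$ in mean w.r.t.\ $D$ is a function $\tau:(0,\infty)\to(0,\infty)$ such that for all $\varepsilon>0$ and all $x\in D$: $\mathbb{E}[F(x)]<\tau(\varepsilon)$ implies $\mathbb{E}[\mathrm{dist}^\phi_{\mathrm{zer}F}(x)]<\varepsilon$. *)

(* Defs.v *)
From HB Require Import structures.
From mathcomp Require Import all_boot all_order all_algebra.
From mathcomp Require Import all_classical all_reals all_analysis measurable_realfun.
Set Implicit Arguments. Unset Strict Implicit. Unset Printing Implicit Defensive.
Import Order.TTheory GRing.Theory Num.Theory.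
Local Open Scope classical_set_scope.
Local Open Scope ring_scope.

Section MetricDefs.
Context {R : realType} {X : Type} (d : X -> X -> R).

Definition is_metric : Prop :=
  [/\ forall x y, 0 <= d x y,
      forall x y, d x y = 0 <-> x = y,
      forall x y, d x y = d y x &
      forall x y z, d x z <= d x y + d y z].

Definition metric_separable : Prop :=
  exists s : nat -> X, forall x e, 0 < e -> exists n, d x (s n) < e.

Definition metric_complete : Prop :=
  forall u : nat -> X,
    (forall e, 0 < e -> exists N, forall m n, (N <= m)%N -> (N <= n)%N -> d (u m) (u n) < e) ->
    exists l, forall e, 0 < e -> exists N, forall n, (N <= n)%N -> d (u n) l < e.

Definition dball (x : X) (e : R) : set X := [set y | d x y < e].

Definition dopen (U : set X) : Prop :=
  forall x, U x -> exists2 e, 0 < e & dball x e `<=` U.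

Definition dclosed (C : set X) : Prop := dopen (~` C).

Definition dborel : set (set X) := <<s dopen >>.

Definition dmeas_wrt {T : Type} (G : set (set T)) (f : T -> X) : Prop :=
  forall B, dborel B -> G (f @^-1` B).

Definition dcontinuous (f : X -> R) : Prop :=
  forall x e, 0 < e -> exists2 del, 0 < del &
    forall x', d x x' < del -> `|f x' - f x| < e.

End MetricDefs.

Definition rmeas_wrt {R : realType} {T : Type} (G : set (set T)) (f : T -> R) : Prop :=
  forall B : set R, measurable B -> G (f @^-1` B).
Definition emeas_wrt {R : realType} {T : Type} (G : set (set T)) (f : T -> \bar R) : Prop :=
  forall B : set (\bar R), measurable B -> G (f @^-1` B).

Definition caratheodory {R : realType} {X : Type} (d : X -> X -> R) (phi : X -> X -> R) : Prop :=
  (forall x y, 0 <= phi x y) /\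
  (forall y, dcontinuous d (fun x => phi x y)) /\
  (forall x, rmeas_wrt (dborel d) (phi x)).

Definition unif_consistent {R : realType} {X : Type} (d : X -> X -> R) (phi : X -> X -> R)
  (theta : R -> R) : Prop :=
  forall e x y, 0 < e -> phi x y < theta e -> d x y < e.

Definition distphi {R : realType} {X : Type} (phi : X -> X -> R) (S : set X) (x : X) : \bar R :=
  ereal_inf [set (phi s x)%:E | s in S].

Definition filtration {d} {T : measurableType d} (Fn : nat -> set (set T)) : Prop :=
  (forall n, sigma_algebra setT (Fn n)) /\
  (forall n, Fn n `<=` measurable) /\
  (forall n m, (n <= m)%N -> Fn n `<=` Fn m).

(** h is (a version of) the conditional expectation of the nonnegative Y given G *)
Definition is_cond_exp {d} {T : measurableType d} {R : realType} (P : probability T R)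
  (G : set (set T)) (Y : T -> \bar R) (h : T -> \bar R) : Prop :=
  emeas_wrt G h /\
  forall A, G A -> (\int[P]_(w in A) h w = \int[P]_(w in A) Y w)%E.

Definition ell1_plus {d} {T : measurableType d} {R : realType} (P : probability T R)
  (Fn : nat -> set (set T)) (xi : nat -> T -> R) : Prop :=
  (forall n w, 0 <= xi n w) /\
  (forall n, rmeas_wrt (Fn n) (xi n)) /\
  {ae P, forall w, \sum_(0 <= k <oo) (xi k w)%:E < +oo}%E.

Definition strong_stoch_qfejer {d} {T : measurableType d} {R : realType} {X : Type}
  (dX : X -> X -> R) (P : probability T R) (phi : X -> X -> R) (S : set X)
  (Fn : nat -> set (set T)) (x : nat -> T -> X) (zeta xi : nat -> T -> R) : Prop :=
  forall n (z : T -> X),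
    dmeas_wrt dX (Fn n) z ->
    {ae P, forall w, S (z w)} ->
    (\int[P]_w (phi (z w) (x n w))%:E < +oo)%E ->
    exists h, is_cond_exp P (Fn n) (fun w => (phi (z w) (x n.+1 w))%:E) h /\
      {ae P, forall w, h w <= ((1 + zeta n w) * phi (z w) (x n w) + xi n w)%:E}%E.

Definition zer {R : realType} {X : Type} (F : X -> \bar R) : set X := [set z | F z = 0%E].

(* Main.v *)
(* Pick [n0] with E[F (x n0)] small; regularity makes E[dist (x n0)] small, and, [phi]
   being continuous on the left, a near-minimiser [z] can be chosen F_n0-measurably
   among countably many points dense in [zer F].  Quasi-Fejer monotonicity applied to
   this random [z] shows that phi(z, x_n) / prod_(i < n) (1 + zeta_i), for n >= n0, is a
   supermartingale up to the errors [xi], so its mean stays small and Doob's maximal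
   inequality controls its supremum.  Through [theta] this says that [x n] stays close
   to [z] both in mean (by convexity) and uniformly in n with high probability; hence
   almost surely [x n] is Cauchy with limit in the closed set [zer F], and comparing
   both [x n] and the limit with [z] gives the two rates. *)
Require Import Defs.
From HB Require Import structures.
From mathcomp Require Import all_boot all_order all_algebra.
From mathcomp Require Import all_classical all_reals all_analysis measurable_realfun.
From mathcomp Require Import ring lra.
Import Order.TTheory GRing.Theory Num.Theory.
Local Open Scope classical_set_scope.
Local Open Scope ring_scope.

(** The point z depends on the accuracy, and the points for two accuracies need not be related. The
    limit is therefore built once, from closeness to [zer F] at all scales, and each rate then uses
    the z of its own scale through d(x_n, x) <= d(x_n, z) + d(z, x), with half of epsilon per term:
    hence theta(epsilon/2). The second term is inherited from the x_m by a passage to the limit and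
    is only <= epsilon/2; strictness comes from the first. The 3K: E[phi(z, x_n0)] and the tail of
    the E[xi_k] are each below epsilon/(3K), and undoing the normalisation by the products costs a
    factor K, so the total stays below 2 epsilon/3. Two obstacles shape the middle. A conditional
    expectation is given only by its integrals over events of F_n, so dividing by the random product
    means integrating against an F_n-measurable weight. And quasi-Fejer monotonicity may be applied
    to z at time n only once E[phi(z, x_n)] is known to be finite, so integrability is propagated
    step by step. *)

Lemma invS_lt {R : realType} (e : R) : 0 < e -> exists m : nat, m.+1%:R^-1 < e.
Proof.
move=> e0; exists (Num.truncn e^-1); rewrite invf_plt ?posrE //.
exact: truncnS_gt.
Qed.

(** * Measurability with respect to a sub-sigma-algebra *)

Section sub_sigma_algebra.
Context {dT : measure_display} {T : measurableType dT} {R : realType}.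
Variable G : set (set T).
Hypothesis sG : sigma_algebra setT G.

(** Regarding [T] as [g_sigma_algebraType G] makes the general closure lemmas for measurable sets
    and functions available for [G]-measurability; this equation translates back. *)
Lemma measurable_subsigmaE :
  (measurable : set (set (g_sigma_algebraType G))) = G.
Proof. exact: sigma_algebra_id. Qed.

Lemma rmeas_wrtP (f : T -> R) :
  rmeas_wrt G f <-> measurable_fun setT (f : g_sigma_algebraType G -> R).
Proof.
split=> [Gf _ B mB|mf B mB].
  by rewrite setTI measurable_subsigmaE; exact: Gf.
by have := mf measurableT B mB; rewrite setTI measurable_subsigmaE.
Qed.

Hypothesis subG : G `<=` measurable.

Lemma rmeas_wrt_measurable (f : T -> R) : rmeas_wrt G f -> measurable_fun setT f.
Proof. by move=> Gf _ B mB; rewrite setTI; exact/subG/Gf. Qed.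

Lemma emeas_wrt_measurable (f : T -> \bar R) :
  emeas_wrt G f -> measurable_fun setT f.
Proof. by move=> Gf _ B mB; rewrite setTI; exact/subG/Gf. Qed.

Lemma measurable_wrt (f : T -> R) :
  measurable_fun setT (f : g_sigma_algebraType G -> R) -> measurable_fun setT f.
Proof. by move=> /rmeas_wrtP; exact: rmeas_wrt_measurable. Qed.

End sub_sigma_algebra.

(** * Measurable sets, and functions chosen by a random index *)

Section measurable_misc.
Context {dT : measure_display} {T : measurableType dT} {R : realType}.

Lemma measurable_fun_lt_sets (f : T -> R) :
  (forall c, measurable [set w | f w < c]) -> measurable_fun setT f.
Proof.
move=> mf; apply: (measurability _ (RGenInftyO.measurableE R)) => //.
move=> _ [_ [c ->] <-]; rewrite setTI.
by rewrite (_ : _ @^-1` _ = [set w | f w < c]).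
Qed.

Lemma measurable_lt_set (f g : T -> R) : measurable_fun setT f ->
  measurable_fun setT g -> measurable [set w | f w < g w].
Proof.
move=> mf mg; have := @measurable_fun_ltr _ _ _ setT f g mf mg measurableT [set true].
by rewrite setTI; apply.
Qed.

Lemma measurable_le_set (f g : T -> R) : measurable_fun setT f ->
  measurable_fun setT g -> measurable [set w | f w <= g w].
Proof.
move=> mf mg; have := @measurable_fun_ler _ _ _ setT f g mf mg measurableT [set true].
by rewrite setTI; apply.
Qed.

Lemma measurable_funV_gt0 (f : T -> R) : (forall w, 0 < f w) ->
  measurable_fun setT f -> measurable_fun setT (fun w => (f w)^-1).
Proof.
move=> f0 mf.
rewrite (_ : (fun w => _) = (@powR R ^~ (-1)) \o f).
  by apply: measurableT_comp => //; exact: measurable_powR.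
by apply/funext => w /=; rewrite -powR_inv1 ?ltW.
Qed.

Lemma measurable_choice_set (kap : T -> nat) (E : nat -> set T) :
  (forall k, measurable [set w | kap w = k]) -> (forall k, measurable (E k)) ->
  measurable [set w | E (kap w) w].
Proof.
move=> mk mE.
rewrite (_ : [set w | _] = \bigcup_k ([set w | kap w = k] `&` E k)).
  by apply: bigcupT_measurable => k; exact: measurableI.
by apply/seteqP; split=> [w Ew|w [k _ [/= <-]]] //; exists (kap w).
Qed.

(** Used with [f k w = phi (t k) (x n w)]: a random left argument with countably many values reduces
    to fixed left arguments, where the Caratheodory condition gives measurability. *)
Lemma measurable_fun_choice (kap : T -> nat) (f : nat -> T -> R) :
  (forall k, measurable [set w | kap w = k]) ->
  (forall k, measurable_fun setT (f k)) ->
  measurable_fun setT (fun w => f (kap w) w).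
Proof.
move=> mk mf _ B mB; rewrite setTI.
apply: (@measurable_choice_set kap (fun k => f k @^-1` B)) => // k.
by rewrite -[_ @^-1` _]setTI; exact: mf.
Qed.

Lemma measurable_preimage_choice {X : Type} (kap : T -> nat) (t : nat -> X) (B : set X) :
  (forall k, measurable [set w | kap w = k]) ->
  measurable ((fun w => t (kap w)) @^-1` B).
Proof.
move=> mk; apply: (measurable_choice_set kap (fun k => [set w | B (t k)])) => // k.
have [Bt|nBt] := pselect (B (t k)).
  by rewrite (_ : [set _ | _] = setT) //; apply/seteqP; split.
by rewrite (_ : [set _ | _] = set0) //; apply/seteqP; split.
Qed.

(** [kap w = k] means that [E k] holds at [w] and no earlier event does. *)
Lemma measurable_first (E : nat -> set T) (kap : T -> nat) :
  (forall k, measurable (E k)) -> (forall w, E (kap w) w) ->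
  (forall w k, E k w -> (kap w <= k)%N) ->
  forall k, measurable [set w | kap w = k].
Proof.
move=> mE Ek kmin k.
rewrite (_ : [set w | _] = E k `&` \bigcap_(j in [set j | (j < k)%N]) ~` E j).
  apply: measurableI => //; apply: bigcap_measurableType => j _.
  exact: measurableC.
apply/seteqP; split => [w /= <-|w [Ekw lek]].
  by split=> // j /= jk Ej; move: jk; rewrite ltnNge kmin.
apply/eqP; rewrite eqn_leq (kmin _ _ Ekw) /= leqNgt; apply/negP => kk.
exact: (lek _ kk).
Qed.

End measurable_misc.

(** * Borel measurability in a separable metric space *)

Section metric_measurable.
Context {R : realType} {X : Type} (d : X -> X -> R).
Hypothesis d_metric : is_metric d.

Lemma dopen_dball s e : dopen d (dball d s e).
Proof.
have [_ _ _ dtri] := d_metric.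
move=> y /= sy; exists (e - d s y); first by rewrite subr_gt0.
by move=> z; have := dtri s y z; rewrite /dball /=; lra.
Qed.

(** The dense sequence of the space may miss [S]. For each ball around [s k] of radius 1/(m+1) that
    meets [S], a point of [S] in it is chosen; [z0] fills the other indices. *)
Lemma dense_in_subset (S : set X) : metric_separable d -> S !=set0 ->
  exists t : nat -> X, (forall k, S (t k)) /\
    forall y (e : R), S y -> 0 < e -> exists k, d y (t k) < e.
Proof.
have [_ _ dsym dtri] := d_metric.
move=> [s sP] [z0 Sz0].
have /choice[g gP] : forall km : nat * nat, exists y, S y /\
    ((exists y', S y' /\ d y' (s km.1) < km.2.+1%:R^-1) ->
      d y (s km.1) < km.2.+1%:R^-1).
  move=> km; have [[y [Sy ky]]|nex] :=
    pselect (exists y', S y' /\ d y' (s km.1) < km.2.+1%:R^-1); first by exists y.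
  by exists z0.
exists (fun k => if unpickle k is Some km then g km else z0); split.
  by move=> k; case: unpickle => // km; exact: (gP _).1.
move=> y e Sy e0.
have [m em] : exists m : nat, m.+1%:R^-1 < e / 2 by apply: invS_lt; rewrite divr_gt0.
have [k yk] : exists k, d y (s k) < m.+1%:R^-1 by apply: sP; rewrite invr_gt0.
exists (pickle (k, m)); rewrite pickleK /=.
have /= := (gP (k, m)).2 (ex_intro _ y (conj Sy yk)).
have := dtri y (s k) (g (k, m)); rewrite (dsym (s k)).
by move: yk em; set q := _^-1; lra.
Qed.

Context {dT : measure_display} {T : measurableType dT}.

Lemma measurable_dist_cst (s : X) (f : T -> X) : dmeas_wrt d measurable f ->
  measurable_fun setT (fun w => d s (f w)).
Proof.
move=> mf; apply: measurable_fun_lt_sets => c.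
by apply: (mf (dball d s c)); apply: sub_sigma_algebra; exact: dopen_dball.
Qed.

(** By separability, [d (f w) (g w) < c] holds exactly when the path through some [s k] is already
    shorter than [c], which leaves only distances to fixed points. *)
Lemma measurable_dist (f g : T -> X) : metric_separable d ->
  dmeas_wrt d measurable f -> dmeas_wrt d measurable g ->
  measurable_fun setT (fun w => d (f w) (g w)).
Proof.
have [_ _ dsym dtri] := d_metric.
move=> [s sP] mf mg; apply: measurable_fun_lt_sets => c.
rewrite (_ : [set w | _] = \bigcup_k [set w | d (s k) (f w) + d (s k) (g w) < c]).
  apply: bigcupT_measurable => k; apply: measurable_lt_set => //.
  by apply: measurable_funD; exact: measurable_dist_cst.
apply/seteqP; split => [w /= fg|w [k _ /=]].
  (* The detour through [s k] costs at most twice [d (f w) (s k)], so half of the slack suffices. *)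
  have [k fk] : exists k, d (f w) (s k) < (c - d (f w) (g w)) / 2.
    by apply: sP; lra.
  exists k => //=; have := dtri (s k) (f w) (g w).
  by rewrite (dsym (s k) (f w)); lra.
by have := dtri (f w) (s k) (g w); rewrite (dsym (f w) (s k)); lra.
Qed.

(** An open set is a countable union of balls centred at the [s k]. The criterion suits limits,
    since distances to a fixed point pass to the limit. *)
Lemma dmeas_of_dist (f : T -> X) : metric_separable d ->
  (forall s, measurable_fun setT (fun w => d s (f w))) ->
  dmeas_wrt d measurable f.
Proof.
have [_ _ dsym dtri] := d_metric.
move=> [s sP] mf B; rewrite /dborel.
suff : <<s dopen d >> `<=` [set B | measurable (f @^-1` B)] by apply.
apply: smallest_sub.
  split=> /=; first by rewrite preimage_set0.
    by move=> A mA; rewrite setTD preimage_setC; exact: measurableC.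
  by move=> A mA; rewrite preimage_bigcup; exact: bigcupT_measurable.
move=> U oU /=.
rewrite (_ : _ @^-1` _ = \bigcup_k \bigcup_(m in
    [set m : nat | dball d (s k) m.+1%:R^-1 `<=` U])
    [set w | d (s k) (f w) < m.+1%:R^-1]).
  apply: bigcupT_measurable => k; apply: bigcup_measurable => m _.
  exact: measurable_lt_set.
apply/seteqP; split => [w /= /oU [e e0 eU]|w [k _ [m /= mU] /mU]] //.
have [m em] : exists m : nat, m.+1%:R^-1 < e / 2 by apply: invS_lt; rewrite divr_gt0.
have [k yk] : exists k, d (f w) (s k) < m.+1%:R^-1.
  by apply: sP; rewrite invr_gt0.
exists k => //; exists m => /=; last by rewrite dsym.
move=> y /= ky; apply: eU => /=.
have := dtri (f w) (s k) y; rewrite /dball /= in ky *.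
by move: yk em ky; set q := _^-1; lra.
Qed.

End metric_measurable.

Section nonneg_integral.
Context {dT : measure_display} {T : measurableType dT} {R : realType}.
Variable mu : {measure set T -> \bar R}.
Implicit Types (f g : T -> R) (A : set T).

Lemma ge0_integralD_EFin A f g : measurable A ->
  (forall w, 0 <= f w) -> measurable_fun setT f ->
  (forall w, 0 <= g w) -> measurable_fun setT g ->
  (\int[mu]_(w in A) (f w + g w)%:E =
   \int[mu]_(w in A) (f w)%:E + \int[mu]_(w in A) (g w)%:E)%E.
Proof.
move=> mA f0 mf g0 mg; under eq_integral do rewrite EFinD.
by apply: ge0_integralD => // [w _||w _|]; rewrite ?lee_fin //;
  apply/measurable_EFinP; exact: measurable_funTS.
Qed.

Lemma ge0_integralM_EFin A (c : R) f : measurable A -> 0 <= c ->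
  (forall w, 0 <= f w) -> measurable_fun setT f ->
  (\int[mu]_(w in A) (c * f w)%:E = c%:E * \int[mu]_(w in A) (f w)%:E)%E.
Proof.
move=> mA c0 f0 mf; under eq_integral do rewrite EFinM.
by apply: ge0_integralZl_EFin => // [w _|]; rewrite ?lee_fin //;
  apply/measurable_EFinP; exact: measurable_funTS.
Qed.

Lemma ge0_le_integral_EFin A f g : measurable A ->
  (forall w, 0 <= f w) -> measurable_fun setT f -> measurable_fun setT g ->
  (forall w, A w -> f w <= g w) ->
  (\int[mu]_(w in A) (f w)%:E <= \int[mu]_(w in A) (g w)%:E)%E.
Proof.
move=> mA f0 mf mg fg; apply: ge0_le_integral => //=.
- by move=> w _; rewrite lee_fin.
- exact/measurable_EFinP/measurable_funTS.
- exact/measurable_EFinP/measurable_funTS.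
Qed.

Lemma integral_indicM A f : measurable A ->
  (\int[mu]_(w in A) (f w)%:E = \int[mu]_w (\1_A w * f w)%:E)%E.
Proof.
move=> mA; rewrite integral_mkcond epatch_indic.
by apply: eq_integral => w _ /=; rewrite EFinM muleC.
Qed.

End nonneg_integral.

(** * Testing inequalities known on events against bounded weights *)

Lemma sum_le_truncn {R : realType} (y : R) (M : nat) :
  \sum_(i < M) (i.+1%:R <= y)%R%:R = (minn M (Num.truncn y))%:R :> R.
Proof.
elim: M => [|M IH]; first by rewrite big_ord0 min0n.
rewrite big_ord_recr /= IH -truncn_gt_nat -natrD; congr (_%:R).
by case: (ltnP M (Num.truncn y)) => h; rewrite /= ?addn1 ?addn0;
  [rewrite (minn_idPl _) ?(minn_idPl _) // ltnW|
   rewrite (minn_idPr _) ?(minn_idPr _) // leqW].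
Qed.

(* A test function with values in [0, 1] is within 1/M of the average of the
   indicators of its M superlevel sets at heights 1/M, ..., M/M. *)
Section weight.
Context {dT : measure_display} {T : measurableType dT} {R : realType}.
Variables (mu : {measure set T -> \bar R}) (G : set (set T)).
Hypotheses (sG : sigma_algebra setT G) (subG : G `<=` measurable).

Let step (g : T -> R) M (w : T) : R :=
  M.+1%:R^-1 * \sum_(i < M.+1) \1_[set v | i.+1%:R <= M.+1%:R * g v] w.

Let step_bounds (g : T -> R) M w : 0 <= g w <= 1 ->
  step g M w <= g w <= step g M w + M.+1%:R^-1.
Proof.
move=> /andP[g0 g1]; rewrite /step.
rewrite (eq_bigr (fun i : 'I_M.+1 => (i.+1%:R <= M.+1%:R * g w)%R%:R)); last first.
  move=> i _; rewrite indicE; congr (nat_of_bool _)%:R.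
  by apply/idP/idP => [/set_mem|? ]; last exact/mem_set.
(* The number of levels reached is the integer part of (M+1) g(w), so the average is g(w) rounded
   down to a multiple of 1/(M+1). *)
rewrite sum_le_truncn.
have M0 : 0 < M.+1%:R :> R by [].
have y0 : 0 <= M.+1%:R * g w by rewrite mulr_ge0.
have /andP[ty yt] := truncn_itv y0.
have tM : (Num.truncn (M.+1%:R * g w) <= M.+1)%N.
  by rewrite -(ler_nat R) (le_trans ty) // ler_piMr.
rewrite (minn_idPr tM) -[X in _ + X]mulr1 -mulrDr.
rewrite ![_^-1 * _]mulrC ler_pdivrMr // ler_pdivlMr // -natr1 in ty yt *.
by rewrite ![g w * _]mulrC -natr1 in ty yt *; rewrite ty ltW // natr1.
Qed.

(** On superlevel sets of [g] the hypothesis applies directly; replacing [g] by its step function on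
    the left costs at most 1/(M+1) times the finite integral of [Y], and on the right the step
    function is simply bounded by [g]. *)
Lemma integral_weight (Y W g : T -> R) :
  (forall w, 0 <= Y w) -> measurable_fun setT Y ->
  (forall w, 0 <= W w) -> measurable_fun setT W ->
  (\int[mu]_w (Y w)%:E < +oo)%E ->
  (forall A, G A -> (\int[mu]_(w in A) (Y w)%:E <= \int[mu]_(w in A) (W w)%:E)%E) ->
  (forall w, 0 <= g w <= 1) -> rmeas_wrt G g ->
  (\int[mu]_w (g w * Y w)%:E <= \int[mu]_w (g w * W w)%:E)%E.
Proof.
move=> Y0 mY W0 mW Yfin YW g01 Gg.
have mg : measurable_fun setT g by exact: rmeas_wrt_measurable Gg.
have g0 w : 0 <= g w by have /andP[] := g01 w.
pose E M i := [set v | i.+1%:R <= M.+1%:R * g v].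
have GE M i : G (E M i).
  have : measurable (E M i : set (g_sigma_algebraType G)).
    apply: measurable_le_set => //; apply: measurable_funM => //.
    exact/rmeas_wrtP.
  by rewrite measurable_subsigmaE.
have mE M i : measurable (E M i) by exact: subG.
have step0 M w : 0 <= step g M w.
  by rewrite mulr_ge0 ?invr_ge0 ?sumr_ge0 // => i _; rewrite indicE.
have mstep M : measurable_fun setT (step g M).
  apply: measurable_funM => //; apply: measurable_sum => i.
  exact/measurable_indic/mE.
have intstep M (V : T -> R) : (forall w, 0 <= V w) -> measurable_fun setT V ->
    (\int[mu]_w (step g M w * V w)%:E =
     M.+1%:R^-1%:E * \sum_(i < M.+1) \int[mu]_(w in E M i) (V w)%:E)%E.
  move=> V0 mV.
  under eq_integral do rewrite /step -mulrA mulr_suml.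
  have mterm (i : 'I_M.+1) : measurable_fun setT (fun w => \1_(E M i) w * V w).
    by apply: measurable_funM => //; exact/measurable_indic/mE.
  rewrite (ge0_integralM_EFin mu setT M.+1%:R^-1
    (fun w => \sum_(i < M.+1) \1_(E M i) w * V w)) //; last 2 first.
  - by move=> w; apply: sumr_ge0 => i _; rewrite mulr_ge0 // indicE.
  - exact: measurable_sum.
  congr (_ * _)%E; under eq_integral do rewrite -sumEFin.
  rewrite ge0_integral_sum //.
  + by apply: eq_bigr => i _; rewrite integral_indicM.
  + by move=> i; exact/measurable_EFinP.
  + by move=> i w _; rewrite lee_fin mulr_ge0 // indicE.
have Yge0 : (0 <= \int[mu]_w (Y w)%:E)%E by apply: integral_ge0 => w _; rewrite lee_fin.
have [c cE] : exists c : R, (\int[mu]_w (Y w)%:E = c%:E)%E.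
  by exists (fine (\int[mu]_w (Y w)%:E)%E); rewrite fineK // ge0_fin_numE.
have c0 : 0 <= c by rewrite -lee_fin -cE.
apply/lee_addgt0Pr => e e0.
pose M := Num.truncn (c / e).
have ce : M.+1%:R^-1 * c <= e.
  rewrite mulrC ler_pdivrMr // mulrC -ler_pdivrMr //.
  exact/ltW/truncnS_gt.
apply: (@le_trans _ _ (\int[mu]_w (step g M w * Y w + M.+1%:R^-1 * Y w)%:E)%E).
  apply: ge0_le_integral_EFin => //.
  - by move=> w; rewrite mulr_ge0.
  - exact: measurable_funM.
  - by apply: measurable_funD; apply: measurable_funM.
  - move=> w _; rewrite -mulrDl ler_wpM2r //.
    by have /andP[] := step_bounds g M w (g01 w).
rewrite ge0_integralD_EFin //; last 4 first.
- by move=> w; rewrite mulr_ge0.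
- exact: measurable_funM.
- by move=> w; rewrite mulr_ge0 ?invr_ge0.
- exact: measurable_funM.
rewrite (ge0_integralM_EFin mu setT M.+1%:R^-1) ?invr_ge0 // cE.
apply: leeD; last by rewrite -EFinM lee_fin.
apply: (@le_trans _ _ (\int[mu]_w (step g M w * W w)%:E)%E).
  rewrite !intstep // lee_pmul2l ?lte_fin ?invr_gt0 //.
  by apply: lee_sum => i _; exact: YW.
apply: ge0_le_integral_EFin => //.
- by move=> w; rewrite mulr_ge0.
- exact: measurable_funM.
- exact: measurable_funM.
- by move=> w _; rewrite ler_wpM2r //; have /andP[] := step_bounds g M w (g01 w).
Qed.

End weight.

(** * A maximal inequality for almost supermartingales *)

Lemma sume_recr {R : realType} (u : nat -> \bar R) n :
  (\sum_(k < n.+1) u k = \sum_(k < n) u k + u n)%E.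
Proof. by rewrite big_ord_recr. Qed.

Section maximal_inequality.
Context {dT : measure_display} {T : measurableType dT} {R : realType}.
Variables (P : probability T R) (Fn : nat -> set (set T)).
Hypothesis Fn_filt : filtration Fn.
Variables Y xi : nat -> T -> R.
Hypotheses (Y0 : forall n w, 0 <= Y n w) (FY : forall n, rmeas_wrt (Fn n) (Y n)).
Hypotheses (xi0 : forall n w, 0 <= xi n w)
  (mxi : forall n, measurable_fun setT (xi n)).
Hypothesis drift : forall n A, Fn n A ->
  (\int[P]_(w in A) (Y n.+1 w)%:E <=
   \int[P]_(w in A) (Y n w)%:E + \int[P]_(w in A) (xi n w)%:E)%E.

Let sFn n : sigma_algebra setT (Fn n). Proof. exact: Fn_filt.1. Qed.
Let subFn n : Fn n `<=` measurable. Proof. exact: Fn_filt.2.1. Qed.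
Let mY n : measurable_fun setT (Y n).
Proof. exact: rmeas_wrt_measurable (@subFn n) _ (FY n). Qed.

Lemma drift_mean n :
  (\int[P]_w (Y n w)%:E <=
   \int[P]_w (Y 0 w)%:E + \sum_(k < n) \int[P]_w (xi k w)%:E)%E.
Proof.
elim: n => [|n IH]; first by rewrite big_ord0 adde0.
have FT : Fn n setT by rewrite -(measurable_subsigmaE _ (sFn n)).
apply: (le_trans (drift n _ FT)).
rewrite (sume_recr (fun k => \int[P]_w (xi k w)%:E)%E) [X in (_ <= X)%E]addeA.
by apply: leeD.
Qed.

Variable c : R.
Hypothesis c0 : 0 < c.

(** Markov's inequality on the part of [A] where the level is reached, keeping the rest of the mass
    for the next step. *)
Let split_level n A : measurable A ->
  (\int[P]_(w in A `&` [set w | (Y n w < c)%R]) (Y n w)%:E +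
     c%:E * P (A `&` [set w | (c <= Y n w)%R]) <= \int[P]_(w in A) (Y n w)%:E)%E.
Proof.
move=> mA.
have mlt : measurable (A `&` [set w | Y n w < c]).
  by apply: measurableI => //; exact: measurable_lt_set.
have mle : measurable (A `&` [set w | c <= Y n w]).
  by apply: measurableI => //; exact: measurable_le_set.
have AE : A = (A `&` [set w | Y n w < c]) `|` (A `&` [set w | c <= Y n w]).
  rewrite -setIUr -[LHS]setIT; congr (_ `&` _); apply/seteqP; split=> // w _ /=.
  by case: (ltP (Y n w) c); [left|right].
rewrite [X in (_ <= integral _ X _)%E]AE ge0_integral_setU //; last 3 first.
- exact/measurable_EFinP/measurable_funTS.
- by move=> w _; rewrite lee_fin.
- apply/disj_setPS => w [[_ /=]] /lt_geF h [_ /=].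
  by rewrite h.
apply: leeD => //; rewrite -integral_cst //.
apply: (ge0_le_integral_EFin P _ (fun=> c) (Y n)) => //.
- by move=> w; exact: ltW.
- by move=> w [].
Qed.

Let below n := [set w | forall k, (k <= n)%N -> Y k w < c].

Let belowS n : below n.+1 = below n `&` [set w | Y n.+1 w < c].
Proof.
apply/seteqP; split=> [w h|w [h h1] k].
  by split=> [k kn|]; apply: h => //; exact: leqW.
by rewrite leq_eqVlt ltnS => /predU1P[->|/h].
Qed.

Let below0 : below 0 = setT `&` [set w | Y 0 w < c].
Proof.
apply/seteqP; split=> [w h|w [_ h1] k]; first by split=> //; exact: h.
by rewrite leqn0 => /eqP ->.
Qed.

(** That the level has not been passed by time n is decided by time n, so [drift] may be applied on
    this event. *)
Let Fbelow n : Fn n (below n).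
Proof.
have lt_set m : (m <= n)%N -> Fn n [set w | Y m w < c].
  move=> mn; apply: (Fn_filt.2.2 _ _ mn).
  rewrite -(measurable_subsigmaE _ (sFn m)).
  by apply: measurable_lt_set => //; exact/rmeas_wrtP.
rewrite (_ : below n = \bigcap_(k in [set k | (k <= n)%N]) [set w | Y k w < c]).
  rewrite -(measurable_subsigmaE _ (sFn n)).
  apply: bigcap_measurableType => k kn.
  by rewrite measurable_subsigmaE //; exact: lt_set.
by apply/seteqP; split=> [w h k kn|w h k kn]; exact: h.
Qed.

Let mbelow n : measurable (below n). Proof. exact: subFn. Qed.

(* Doob's argument: the mass of [Y] stopped at its first passage above [c]. *)
Let stopped n :
  (\int[P]_(w in below n) (Y n w)%:E + c%:E * P (~` below n) <=
   \int[P]_w (Y 0 w)%:E + \sum_(k < n) \int[P]_w (xi k w)%:E)%E.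
Proof.
elim: n => [|n IH].
  rewrite big_ord0 adde0; have := split_level 0 _ measurableT.
  rewrite -below0; congr (_ + _ * P _ <= _)%E.
  rewrite below0 !setTI; apply/seteqP; split=> w /=.
    by rewrite leNgt => /negP.
  by move=> /negP; rewrite -leNgt.
(* The paths that have passed by n+1 split into those crossing exactly at n+1 and those that crossed
   before. *)
have PE : P (~` below n.+1) =
    (P (below n `&` [set w | (c <= Y n.+1 w)%R]) + P (~` below n))%E.
  rewrite -measureU //; last 3 first.
  - by apply: measurableI => //; exact: measurable_le_set.
  - exact: measurableC.
  - by rewrite -setIA [_ `&` ~` _]setIC setIA setICr set0I.
  congr (P _); rewrite belowS; apply/seteqP; split=> [w /= h|w [[bw /= cw]|nb []//]].
    have [bw|nb] := pselect (below n w); last by right.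
    left; split=> //=; rewrite leNgt; apply/negP => yc; exact: h.
  by move=> [_ /=]; rewrite ltNge cw.
rewrite PE (sume_recr (fun k => \int[P]_w (xi k w)%:E)%E) [X in (_ <= X)%E]addeA.
apply: (@le_trans _ _ ((\int[P]_(w in below n) (Y n w)%:E +
    \int[P]_(w in below n) (xi n w)%:E) + c%:E * P (~` below n))%E); last first.
  rewrite [X in (X <= _)%E]addeAC; apply: leeD => //.
  apply: ge0_subset_integral => //; first exact/measurable_EFinP.
  by move=> w _; rewrite lee_fin.
apply: (@le_trans _ _ (\int[P]_(w in below n) (Y n.+1 w)%:E +
    c%:E * P (~` below n))%E); last by apply: leeD => //; exact: drift.
rewrite ge0_muleDr ?measure_ge0 // [X in (X <= _)%E]addeA; apply: leeD => //.
by rewrite belowS; exact: split_level.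
Qed.

Lemma drift_maximal (B : \bar R) :
  (forall n, (\int[P]_w (Y 0 w)%:E + \sum_(k < n) \int[P]_w (xi k w)%:E <= B)%E) ->
  (c%:E * P [set w | exists n, (c <= Y n w)%R] <= B)%E.
Proof.
move=> YB.
have bE : [set w | exists n, (c <= Y n w)%R] = \bigcup_n (~` below n).
  apply/seteqP; split=> [w [n cn]|w [n _ nb]].
    by exists n => // /(_ n (leqnn n)); rewrite ltNge cn.
  apply: contrapT => h; apply: nb => k kn; rewrite ltNge; apply/negP => ck.
  by apply: h; exists k.
rewrite -lee_pdivlMl // bE.
have cv : (P \o (fun n => ~` below n)) @ \oo --> P (\bigcup_n (~` below n)).
  apply: nondecreasing_cvg_mu.
  - by move=> n; exact: measurableC.
  - by apply: bigcupT_measurable => n; exact: measurableC.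
  - move=> n m nm; apply/subsetPset => w nb bm; apply: nb => k kn.
    by apply: bm; exact: leq_trans nm.
rewrite -(cvg_lim _ cv) //; apply: lime_le; first by apply/cvg_ex; eexists; exact: cv.
apply: nearW => n /=; rewrite lee_pdivlMl //.
apply: le_trans (YB n); apply: le_trans (stopped n).
by apply: leeDr; apply: integral_ge0 => w _; rewrite lee_fin.
Qed.

End maximal_inequality.

(** * Supporting lines and Jensen's inequality for the modulus *)

Section convex_modulus.
Context {R : realType} (theta : R -> R).
Hypothesis theta_convex : forall a b t : R, 0 <= a -> 0 <= b -> 0 <= t <= 1 ->
      theta (t * a + (1 - t) * b) <= t * theta a + (1 - t) * theta b.
Hypotheses (theta0 : theta 0 = 0) (theta_pos : forall e : R, 0 < e -> 0 < theta e).

(** The three-chord inequality: [a] is the convex combination of [y] and [z] with weight (z - a)/(z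
    - y) on [y]. *)
Let slopes (y a z : R) : 0 <= y -> y < a -> a < z ->
  (theta a - theta y) / (a - y) <= (theta z - theta a) / (z - a).
Proof.
move=> y0 ya az.
have zy : 0 < z - y by lra.
rewrite ler_pdivrMr ?subr_gt0 // mulrAC ler_pdivlMr ?subr_gt0 //.
have z0 : 0 <= z by lra.
have t01 : 0 <= (z - a) / (z - y) <= 1.
  by rewrite divr_ge0 ?ler_pdivrMr //; lra.
have := theta_convex y z _ y0 z0 t01.
rewrite (_ : _ * y + _ = a); last by field; lra.
rewrite -(ler_pM2r zy) (_ : (_ + _) * (z - y) =
  (z - a) * theta y + (a - y) * theta z); last by field; lra.
nra.
Qed.

(** The slope is the supremum of the chord slopes to the left of [a], which every chord slope to the
    right bounds. The chord from 0 has slope theta(a)/a > 0, so [c] can later be cancelled. The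
    inequality is written without subtraction so that both sides can be integrated as nonnegative
    functions. *)
Lemma convex_support (a : R) : 0 < a ->
  exists c, 0 < c /\ forall y, 0 <= y -> c * y + theta a <= theta y + c * a.
Proof.
move=> a0.
pose L := [set (theta a - theta y) / (a - y) | y in [set y | 0 <= y < a]].
have Lne : L !=set0.
  by exists ((theta a - theta 0) / (a - 0)); exists 0 => //=; rewrite lexx a0.
have Lub z : a < z -> ubound L ((theta z - theta a) / (z - a)).
  by move=> az _ [y /= /andP[y0 ya] <-]; exact: slopes.
have hL : has_ubound L.
  by exists ((theta (a + 1) - theta a) / (a + 1 - a)); apply: Lub; lra.
have Lle y : 0 <= y -> y < a -> (theta a - theta y) / (a - y) <= sup L.
  by move=> y0 ya; apply: ub_le_sup => //; exists y => //=; rewrite y0 ya.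
exists (sup L); split.
  apply: lt_le_trans (Lle 0 (lexx _) a0).
  by rewrite theta0 !subr0 divr_gt0 // theta_pos.
move=> y y0; case: (ltgtP y a) => [ya|ay|->]; last by rewrite addrC.
  have := Lle y y0 ya; rewrite ler_pdivrMr ?subr_gt0 //; nra.
have : sup L <= (theta y - theta a) / (y - a) by apply: ge_sup => //; exact: Lub.
rewrite ler_pdivlMr ?subr_gt0 //; nra.
Qed.

Context {dT : measure_display} {T : measurableType dT} (P : probability T R).

(* Jensen's inequality for [theta], in contrapositive form. *)
Lemma mean_lt_of_modulus (f g : T -> R) (a : R) : 0 < a ->
  (forall w, 0 <= f w) -> measurable_fun setT f ->
  (forall w, 0 <= g w) -> measurable_fun setT g ->
  (forall w, theta (f w) <= g w) ->
  (\int[P]_w (g w)%:E < (theta a)%:E)%E -> (\int[P]_w (f w)%:E < a%:E)%E.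
Proof.
move=> a0 f0 mf g0 mg fg ga.
have [c [c0 cP]] := convex_support a a0.
have cst_int (r : R) : (\int[P]_w (r%:E) = r%:E)%E.
  by rewrite [LHS](integral_cst P measurableT) /= probability_setT mule1.
have : (\int[P]_w (c * f w + theta a)%:E <= \int[P]_w (g w + c * a)%:E)%E.
  apply: ge0_le_integral_EFin => //.
  - by move=> w; rewrite addr_ge0 ?mulr_ge0 // ltW // theta_pos.
  - by apply: measurable_funD => //; exact: measurable_funM.
  - exact: measurable_funD.
  - by move=> w _; apply: (le_trans (cP _ (f0 w))); rewrite lerD2r.
rewrite !ge0_integralD_EFin //; last 4 first.
- by move=> _; rewrite mulr_ge0 // ltW.
- by move=> w; rewrite mulr_ge0 // ltW.
- exact: measurable_funM.
- by move=> _; rewrite ltW // theta_pos.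
rewrite ge0_integralM_EFin ?(ltW c0) // !cst_int => h.
rewrite -(lte_pmul2l (z := c%:E)) // ?lte_fin //.
have th : (theta a)%:E \is a fin_num by [].
rewrite -(lteD2rE _ _ th); apply: (le_lt_trans h).
by rewrite addeC -EFinM lteD2lE.
Qed.

End convex_modulus.

(** * Measurable selection of near-minimisers *)

Section selection.
Context {R : realType} {X : Type} (d : X -> X -> R) (phi : X -> X -> R).
Hypothesis phi_car : caratheodory d phi.
Variables (S : set X) (t : nat -> X).
Hypotheses (St : forall k, S (t k))
  (t_dense : forall y (e : R), S y -> 0 < e -> exists k, d y (t k) < e).

(** Left continuity of [phi] lets a dense sequence replace [S]; as a countable infimum the distance
    becomes measurable. *)
Lemma distphi_dense y : distphi phi S y = einfs (fun k => (phi (t k) y)%:E) 0.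
Proof.
have [phi0 [phic _]] := phi_car.
apply/eqP; rewrite eq_le; apply/andP; split.
  apply: ereal_inf_le_tmp => _ [k _ <-].
  by exists (t k).
apply: le_ereal_inf_tmp => _ [s Ss <-]; apply/lee_addgt0Pr => e e0.
have [del del0 delP] := phic y s e e0.
have [k sk] := t_dense s del Ss del0.
apply: (@le_trans _ _ (phi (t k) y)%:E).
  by apply: ereal_inf_lbound; exists k.
by rewrite -EFinD lee_fin; have := delP _ sk; rewrite ltr_distl => /andP[_ /ltW].
Qed.

Context {dT : measure_display} {T : measurableType dT}.
Variables (P : probability T R) (G : set (set T)).
Hypotheses (sG : sigma_algebra setT G) (subG : G `<=` measurable).

Lemma near_minimiser (y : T -> X) (del : R) : dmeas_wrt d G y ->
  (\int[P]_w distphi phi S (y w) < del%:E)%E ->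
  exists kap : T -> nat, (forall k, G [set w | kap w = k]) /\
    (\int[P]_w (phi (t (kap w)) (y w))%:E < del%:E)%E.
Proof.
have [phi0 [phic phim]] := phi_car.
move=> Gy ydel.
pose r w := fine (distphi phi S (y w)).
have D0 w : (0 <= distphi phi S (y w))%E.
  by apply: le_ereal_inf_tmp => _ [s _ <-]; rewrite lee_fin.
have rE w : distphi phi S (y w) = (r w)%:E.
  rewrite fineK // ge0_fin_numE //.
  apply: (@le_lt_trans _ _ (phi (t 0) (y w))%:E); last exact: ltry.
  by apply: ereal_inf_lbound; exists (t 0).
have r0 w : 0 <= r w by exact: fine_ge0.
have Gphi k : measurable_fun setT
    ((fun w => phi (t k) (y w)) : g_sigma_algebraType G -> R).
  by apply/(rmeas_wrtP _ sG) => B mB; apply: (Gy (phi (t k) @^-1` B)); exact: phim.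
have Gr : measurable_fun setT (r : g_sigma_algebraType G -> R).
  apply/measurable_EFinP.
  rewrite (_ : EFin \o r = fun w => einfs (fun k => (phi (t k) (y w))%:E) 0).
    apply: (@measurable_fun_einfs _ (g_sigma_algebraType G) R setT
      (fun k w => (phi (t k) (y w))%:E)) => k.
    exact/measurable_EFinP.
  by apply/funext => w /=; rewrite -rE distphi_dense.
have mr : measurable_fun setT r by exact: (measurable_wrt _ sG subG).
have intr_ : (\int[P]_w (r w)%:E < del%:E)%E by under eq_integral do rewrite -rE.
have intr0 : (0 <= \int[P]_w (r w)%:E)%E by apply: integral_ge0 => w _; rewrite lee_fin.
have [v vE] : exists v : R, (\int[P]_w (r w)%:E = v%:E)%E.
  exists (fine (\int[P]_w (r w)%:E)%E); rewrite fineK // ge0_fin_numE //.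
  by apply: (lt_trans intr_); exact: ltry.
rewrite vE lte_fin in intr_.
(* The mean distance [v] lies strictly below [del]; exceeding the infimum by half the gap at each
   point keeps the mean below [del]. *)
pose eta := (del - v) / 2; have eta0 : 0 < eta by rewrite /eta; lra.
have exk w : exists k, phi (t k) (y w) < r w + eta.
  apply: contrapT => nex.
  suff : ((r w + eta)%:E <= (r w)%:E)%E by rewrite lee_fin; lra.
  rewrite -[X in (_ <= X)%E]rE distphi_dense; apply: le_ereal_inf_tmp => _ [k _ <-].
  by rewrite lee_fin leNgt; apply/negP => h; apply: nex; exists k.
(* Taking the least admissible index, rather than an arbitrary one, makes the choice
   [G]-measurable. *)
have /choice[kap kapP] : forall w, exists k, phi (t k) (y w) < r w + eta /\
    forall j, phi (t j) (y w) < r w + eta -> (k <= j)%N.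
  by move=> w; case: (ex_minnP (exk w)) => k h1 h2; exists k; split.
exists kap.
have Gk k : G [set w | kap w = k].
  rewrite -(measurable_subsigmaE G sG).
  apply: (@measurable_first _ (g_sigma_algebraType G)
    (fun k => [set w | phi (t k) (y w) < r w + eta])) => //.
  - move=> j; apply: (@measurable_lt_set _ (g_sigma_algebraType G)) => //.
    exact: measurable_funD.
  - by move=> w; exact: (kapP w).1.
  - by move=> w j; exact: (kapP w).2.
split=> //.
apply: (@le_lt_trans _ _ (\int[P]_w (r w + eta)%:E)%E).
  apply: ge0_le_integral_EFin => //.
  - apply: (measurable_fun_choice kap (fun k w => phi (t k) (y w))) => k.
      exact: subG.
    exact: (measurable_wrt _ sG subG).
  - exact: measurable_funD.
  - by move=> w _; exact/ltW/(kapP w).1.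
rewrite ge0_integralD_EFin ?(ltW eta0) // vE.
rewrite [X in (_ + X < _)%E](integral_cst P measurableT) /= probability_setT mule1.
by rewrite -EFinD lte_fin /eta; lra.
Qed.

End selection.

(** No sign is imposed on [h], so its integral is first bounded by that of its positive part, which
    the nonnegative [W] still dominates almost everywhere. *)
Lemma cond_exp_le {dT : measure_display} {T : measurableType dT} {R : realType}
  (P : probability T R) (G : set (set T)) (Y W : T -> R) (h : T -> \bar R) :
  G `<=` measurable -> is_cond_exp P G (EFin \o Y) h ->
  (forall w, 0 <= W w) -> measurable_fun setT W ->
  {ae P, forall w, (h w <= (W w)%:E)%E} ->
  forall A, G A -> (\int[P]_(w in A) (Y w)%:E <= \int[P]_(w in A) (W w)%:E)%E.
Proof.
move=> subG [Gh hY] W0 mW hW A GA.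
have mh : measurable_fun setT h by exact: emeas_wrt_measurable Gh.
rewrite -[X in (X <= _)%E](hY A GA) integralE.
apply: (@le_trans _ _ (\int[P]_(w in A) h^\+ w)%E).
  rewrite -[X in (_ <= X)%E]sube0; apply: leeB => //.
  by apply: integral_ge0 => w _; exact: funeneg_ge0.
apply: ae_ge0_le_integral.
- exact: subG.
- by move=> w _; exact: funepos_ge0.
- by apply: measurable_funTS; exact: measurable_funepos.
- by move=> w _; rewrite lee_fin.
- exact/measurable_EFinP/measurable_funTS.
apply: filterS hW => w hw _.
by rewrite funeposE ge_max hw lee_fin W0.
Qed.

(** * Quasi-Fejer monotonicity at a random point of the solution set *)

Section fejer.
Context {R : realType} {X : Type} (d : X -> X -> R).
Context {dO : measure_display} {Omega : measurableType dO} (P : probability Omega R).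
Variable Fn : nat -> set (set Omega).
Hypothesis Fn_filt : filtration Fn.
Variables (phi : X -> X -> R) (S : set X).
Hypothesis phi_car : caratheodory d phi.
Variable x : nat -> Omega -> X.
Hypothesis x_adapted : forall n, dmeas_wrt d (Fn n) (x n).
Variables zeta xi : nat -> Omega -> R.
Hypotheses (zeta_l1 : ell1_plus P Fn zeta) (xi_l1 : ell1_plus P Fn xi).
Hypothesis x_fejer : strong_stoch_qfejer d P phi S Fn x zeta xi.
Variable K : R.
Hypothesis K_bound : {ae P, forall w,
      limn (fun N => (\prod_(i < N) (1 + zeta i w))%:E) < K%:E}%E.

Let sFn n : sigma_algebra setT (Fn n). Proof. exact: Fn_filt.1. Qed.
Let subFn n : Fn n `<=` measurable. Proof. exact: Fn_filt.2.1. Qed.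
Let zeta0 n w : 0 <= zeta n w. Proof. exact: zeta_l1.1. Qed.
Let xi0 n w : 0 <= xi n w. Proof. exact: xi_l1.1. Qed.
Let mzeta n : measurable_fun setT (zeta n).
Proof. exact: rmeas_wrt_measurable (@subFn n) _ (zeta_l1.2.1 n). Qed.
Let mxi n : measurable_fun setT (xi n).
Proof. exact: rmeas_wrt_measurable (@subFn n) _ (xi_l1.2.1 n). Qed.
Let phi0 y z : 0 <= phi y z. Proof. exact: phi_car.1. Qed.

Let p n w : R := \prod_(i < n) (1 + zeta i w).

Let pS n w : p n.+1 w = p n w * (1 + zeta n w).
Proof. by rewrite /p big_ord_recr. Qed.

Let p_ge1 n w : 1 <= p n w.
Proof.
elim: n => [|n IH]; first by rewrite /p big_ord0.
by rewrite pS; have := zeta0 n w; nra.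
Qed.

Let p_gt0 n w : 0 < p n w. Proof. exact: lt_le_trans (p_ge1 n w). Qed.

Let p_ndecr w : nondecreasing_seq (fun N => (p N w)%:E).
Proof.
apply/nondecreasing_seqP => n; rewrite lee_fin pS.
by have := zeta0 n w; have := p_ge1 n w; nra.
Qed.

(** Partial products are nondecreasing, hence below their limit; a single null set serves all n. *)
Let p_lt_K : {ae P, forall w, forall n, p n w < K}.
Proof.
apply: filterS K_bound => w Kw n; rewrite -lte_fin; apply: le_lt_trans Kw.
apply: lime_ge; first exact: ereal_nondecreasing_is_cvgn (p_ndecr w).
by exists n => // m /= nm; exact: p_ndecr.
Qed.

(** The null set where the bound fails is not the whole space; at any point outside it, the empty
    product 1 is below [K]. *)
Lemma product_bound_gt1 : 1 < K.
Proof.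
have [N [mN PN0 NK]] := p_lt_K.
have [w nNw] : exists w, ~ N w.
  apply/existsNP => Nall.
  have NT : N = setT by apply/seteqP; split.
  by move: PN0; rewrite NT probability_setT => /eqP; rewrite onee_eq0.
apply: contrapT => K1; apply/nNw/NK => /(_ 0).
by rewrite /p big_ord0.
Qed.

(** The product up to index n+1 involves only [zeta 0], ..., [zeta n]: it is known one step ahead,
    so its inverse may serve as a weight at time n. *)
Let Fp n : rmeas_wrt (Fn n) (p n.+1).
Proof.
apply/(rmeas_wrtP _ (sFn n)).
apply: measurable_prod => i _; apply: measurable_funD => //.
apply/(rmeas_wrtP _ (sFn n)) => B mB.
apply: (Fn_filt.2.2 i n); first by rewrite -ltnS.
exact: zeta_l1.2.1.
Qed.

Let mp n : measurable_fun setT (p n).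
Proof. by apply: measurable_prod => i _; exact: measurable_funD. Qed.

Variables (t : nat -> X) (n0 : nat) (kap : Omega -> nat).
Hypotheses (St : forall k, S (t k)) (Fkap : forall k, Fn n0 [set w | kap w = k]).
Let Phi n w := phi (t (kap w)) (x n w).
Hypothesis Phi_fin : (\int[P]_w (phi (t (kap w)) (x n0 w))%:E < +oo)%E.
Hypothesis xi_fin : forall n, (n0 <= n)%N -> (\int[P]_w (xi n w)%:E < +oo)%E.

Let Phi0 n w : 0 <= Phi n w. Proof. exact: phi0. Qed.

Let FPhi n m : (n0 <= m)%N -> (n <= m)%N -> rmeas_wrt (Fn m) (Phi n).
Proof.
move=> n0m nm; apply/(rmeas_wrtP _ (sFn m)).
apply: (@measurable_fun_choice _ (g_sigma_algebraType (Fn m)) _ kap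
  (fun k w => phi (t k) (x n w))) => k.
  rewrite measurable_subsigmaE //; exact: (Fn_filt.2.2 _ _ n0m).
apply/(rmeas_wrtP _ (sFn m)) => B mB; apply: (Fn_filt.2.2 _ _ nm).
by apply: (x_adapted n (phi (t k) @^-1` B)); exact: phi_car.2.2.
Qed.

Let mPhi n : measurable_fun setT (Phi n).
Proof.
apply: (rmeas_wrt_measurable _ (@subFn (maxn n0 n))).
by apply: FPhi; rewrite ?leq_maxl ?leq_maxr.
Qed.

Let Fz n : (n0 <= n)%N -> dmeas_wrt d (Fn n) (fun w => t (kap w)).
Proof.
move=> n0n B _; apply: (Fn_filt.2.2 _ _ n0n).
rewrite -(measurable_subsigmaE _ (sFn n0)).
apply: (@measurable_preimage_choice _ (g_sigma_algebraType (Fn n0))) => k.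
by rewrite measurable_subsigmaE.
Qed.

Let W n w := (1 + zeta n w) * Phi n w + xi n w.

Let W0 n w : 0 <= W n w.
Proof.
apply: addr_ge0 => //; apply: mulr_ge0; last exact: phi0.
exact: addr_ge0.
Qed.

Let mW n : measurable_fun setT (W n).
Proof.
by apply: measurable_funD => //; apply: measurable_funM => //; exact: measurable_funD.
Qed.

Let one_step n : (n0 <= n)%N -> (\int[P]_w (Phi n w)%:E < +oo)%E ->
  forall A, Fn n A ->
  (\int[P]_(w in A) (Phi n.+1 w)%:E <= \int[P]_(w in A) (W n w)%:E)%E.
Proof.
move=> n0n Phin.
have Sz : {ae P, forall w, S (t (kap w))} by apply: aeW => w.
have [h [hc hW]] := x_fejer n (fun w => t (kap w)) (Fz n n0n) Sz Phin.
exact: (cond_exp_le P (Fn n) (Phi n.+1) (W n) h).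
Qed.

(** Induction, because [one_step] requires a finite mean at the current time. The random factor is
    harmless: 1 + zeta_n <= p_(n+1) < K almost surely. *)
Let Phi_int n : (n0 <= n)%N -> (\int[P]_w (Phi n w)%:E < +oo)%E.
Proof.
move=> n0n; rewrite -(subnKC n0n); elim: (n - n0)%N => [|k IH]; first by rewrite addn0.
have kn : (n0 <= n0 + k)%N by exact: leq_addr.
rewrite addnS; have K0 : 0 <= K by exact: le_trans (ltW product_bound_gt1).
have FT : Fn (n0 + k)%N setT by rewrite -(measurable_subsigmaE _ (sFn _)).
apply: (le_lt_trans (one_step _ kn IH _ FT)).
apply: (@le_lt_trans _ _ (\int[P]_w (K * Phi (n0 + k) w + xi (n0 + k) w)%:E)%E).
  apply: ae_ge0_le_integral => //.
  - by move=> w _; rewrite lee_fin W0.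
  - exact/measurable_EFinP.
  - by move=> w _; rewrite lee_fin addr_ge0 // mulr_ge0.
  - by apply/measurable_EFinP; apply: measurable_funD => //; exact: measurable_funM.
  apply: filterS p_lt_K => w pK _; rewrite lee_fin lerD2r ler_wpM2r //.
  by apply: le_trans (ltW (pK (n0 + k).+1)); rewrite pS ler_peMl // addr_ge0.
rewrite ge0_integralD_EFin //; last 2 first.
- by move=> w; rewrite mulr_ge0.
- exact: measurable_funM.
rewrite ge0_integralM_EFin // lte_add_pinfty ?xi_fin //.
by apply: lte_mul_pinfty.
Qed.

(** Dividing by the accumulated factors absorbs the 1 + zeta_n and leaves only the additive
    errors. *)
Let Y k w := Phi (n0 + k) w / p (n0 + k) w.

Let mY k : measurable_fun setT (Y k).
Proof. by apply: measurable_funM => //; exact: measurable_funV_gt0. Qed.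

Let Y0 k w : 0 <= Y k w. Proof. by rewrite divr_ge0 // ltW. Qed.

Let FY k : rmeas_wrt (Fn (n0 + k)) (Y k).
Proof.
apply/(rmeas_wrtP _ (sFn _)); apply: measurable_funM.
  by apply/(rmeas_wrtP _ (sFn _)); apply: FPhi; rewrite ?leq_addr.
apply: measurable_funV_gt0 => //; apply: measurable_prod => i _.
apply: measurable_funD => //; apply/(rmeas_wrtP _ (sFn _)) => B mB.
by apply: (Fn_filt.2.2 i _ (ltnW (ltn_ord i))); exact: zeta_l1.2.1.
Qed.

Let drift k A : Fn (n0 + k) A ->
  (\int[P]_(w in A) (Y k.+1 w)%:E <=
   \int[P]_(w in A) (Y k w)%:E + \int[P]_(w in A) (xi (n0 + k) w)%:E)%E.
Proof.
move=> FA; have mA : measurable A by exact: subFn FA.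
have kn : (n0 <= n0 + k)%N by exact: leq_addr.
set n := (n0 + k)%N in FA kn *.
(* The weight: restriction to [A] together with division by the product at n+1, which is at least 1,
   so the values stay in [0, 1]. *)
have Fg : rmeas_wrt (Fn n) (fun w => \1_A w / p n.+1 w).
  apply/(rmeas_wrtP _ (sFn _)); apply: measurable_funM.
    by apply: (@measurable_indic _ (g_sigma_algebraType (Fn n)));
      rewrite measurable_subsigmaE.
  by apply: measurable_funV_gt0 => //; exact/(rmeas_wrtP _ (sFn _))/Fp.
have g01 w : 0 <= \1_A w / p n.+1 w <= 1.
  rewrite divr_ge0 ?ler_pdivrMr ?mul1r ?(ltW (p_gt0 _ _)) ?indicE //=.
  by apply: le_trans (p_ge1 n.+1 w); case: (_ \in _).
have PhiSn : (\int[P]_w (Phi n.+1 w)%:E < +oo)%E by apply: Phi_int; exact: leqW.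
have := integral_weight P (Fn n) (sFn n) (@subFn n) (Phi n.+1) (W n) _
  (fun w => phi0 _ _) (mPhi n.+1) (@W0 n) (mW n) PhiSn
  (one_step _ kn (Phi_int _ kn)) g01 Fg.
rewrite (integral_indicM P A (Y k.+1)) // => h.
rewrite (_ : (\int[P]_w _)%E = \int[P]_w (\1_A w / p n.+1 w * Phi n.+1 w)%:E)%E; last first.
  by apply: eq_integral => w _; rewrite /Y addnS mulrA mulrAC.
apply: (le_trans h).
rewrite -ge0_integralD_EFin // [X in (_ <= X)%E]integral_indicM //.
have g0 w : 0 <= \1_A w / p n.+1 w by have /andP[] := g01 w.
apply: ge0_le_integral_EFin => //.
- by move=> w; rewrite mulr_ge0.
- apply: measurable_funM => //; exact: rmeas_wrt_measurable Fg.
- by apply: measurable_funM; [exact: measurable_indic|exact: measurable_funD].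
(* W_n / p_(n+1) equals Phi_n / p_n + xi_n / p_(n+1), and p_(n+1) >= 1 lets the error be bounded by
   xi_n. *)
move=> w _; rewrite -mulrA ler_wpM2l ?indicE // mulrC ler_pdivrMr //.
rewrite /W /Y -/n pS.
have -> : (Phi n w / p n w + xi n w) * (p n w * (1 + zeta n w)) =
  (1 + zeta n w) * Phi n w + xi n w * (p n w * (1 + zeta n w)).
  by field; rewrite gt_eqF.
by rewrite lerD2l -pS ler_peMr.
Qed.

Let B := (\int[P]_w (phi (t (kap w)) (x n0 w))%:E +
  \sum_(n0 <= k <oo) \int[P]_w (xi k w)%:E)%E.

Let Y_bound n :
  (\int[P]_w (Y 0 w)%:E + \sum_(k < n) \int[P]_w (xi (n0 + k) w)%:E <= B)%E.
Proof.
apply: leeD.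
  apply: ge0_le_integral_EFin => //; first exact: mPhi.
  by move=> w _; rewrite /Y addn0 ler_pdivrMr // ler_peMr.
have xi_ge0 k : (0 <= \int[P]_w (xi k w)%:E)%E.
  by apply: integral_ge0 => w _; rewrite lee_fin.
apply: le_trans (nneseries_lim_ge (n0 + n) _) => //.
rewrite -[X in (_ <= \sum_(X <= _ < _) _)%E]add0n big_addn addKn.
by rewrite big_mkord le_eqVlt; apply/orP; left; apply/eqP; apply: eq_bigr => i _;
  rewrite addnC.
Qed.

Let shifted : filtration (fun k => Fn (n0 + k)).
Proof.
split=> [n|]; first exact: sFn.
split=> [n|n m nm]; first exact: subFn.
by apply: Fn_filt.2.2; rewrite leq_add2l.
Qed.

Let K_gt0 : 0 < K. Proof. exact: lt_trans product_bound_gt1. Qed.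

(** Almost surely Phi <= K Y, since the products stay below [K]; the mean of [Y] is controlled by
    the drift. *)
Lemma fejer_mean n : (n0 <= n)%N ->
  (\int[P]_w (phi (t (kap w)) (x n w))%:E <=
   K%:E * (\int[P]_w (phi (t (kap w)) (x n0 w))%:E +
           \sum_(n0 <= k <oo) \int[P]_w (xi k w)%:E))%E.
Proof.
move=> n0n; rewrite -(subnKC n0n); set k := (n - n0)%N.
apply: (@le_trans _ _ (K%:E * \int[P]_w (Y k w)%:E)%E); last first.
  rewrite lee_pmul2l ?lte_fin //; apply: le_trans (Y_bound k).
  exact: (drift_mean P _ shifted Y (fun k => xi (n0 + k)%N)).
rewrite -ge0_integralM_EFin ?(ltW K_gt0) //.
apply: ae_ge0_le_integral => //.
- by move=> w _; rewrite lee_fin.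
- exact/measurable_EFinP/mPhi.
- by move=> w _; rewrite lee_fin mulr_ge0 // ltW.
- by apply/measurable_EFinP; exact: measurable_funM.
apply: filterS p_lt_K => w pK _; rewrite lee_fin /Y mulrA ler_pdivlMr //.
by rewrite mulrC ler_wpM2r // ltW.
Qed.

Lemma measurable_fejer_event (a : R) :
  measurable [set w | exists n, (n0 <= n)%N /\ a <= phi (t (kap w)) (x n w)].
Proof.
rewrite (_ : [set w | _] = \bigcup_(n in [set n | (n0 <= n)%N]) [set w | a <= Phi n w]).
  by apply: bigcup_measurable => n _; exact: measurable_le_set.
by apply/seteqP; split=> [w [n [h1 h2]]|w [n h1 h2]]; exists n.
Qed.

Lemma fejer_maximal (a : R) : 0 < a ->
  (a%:E * P [set w | exists n, (n0 <= n)%N /\ (a <= phi (t (kap w)) (x n w))%R] <=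
   K%:E * (\int[P]_w (phi (t (kap w)) (x n0 w))%:E +
           \sum_(n0 <= k <oo) \int[P]_w (xi k w)%:E))%E.
Proof.
move=> a0; have aK0 : 0 < a / K by rewrite divr_gt0.
have := drift_maximal P _ shifted Y (fun k => xi (n0 + k)%N) Y0 FY
  (fun k => xi0 _) (fun k => mxi _) drift (a / K) aK0 B Y_bound.
set E' := [set w | _] => max.
have mE' : measurable E'.
  rewrite (_ : E' = \bigcup_k [set w | a / K <= Y k w]).
    by apply: bigcupT_measurable => k; exact: measurable_le_set.
  by apply/seteqP; split=> [w [k h]|w [k _ h]]; exists k.
have [N [mN PN0 NK]] := p_lt_K.
(* Off the null set where some product reaches [K], Phi >= a forces Y >= a/K; adjoining the null set
   costs no probability. *)
have PE : (P [set w | exists n, (n0 <= n)%N /\ (a <= phi (t (kap w)) (x n w))%R] <= P E')%E.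
  have : (P (E' `|` N) <= P E')%E.
    by rewrite -[X in (_ <= X)%E]adde0 -[in X in (_ <= X)%E]PN0; exact: measureU2.
  apply: le_trans.
  apply: le_measure; rewrite ?inE; [exact: measurable_fejer_event|exact: measurableU|].
  move=> w [n [n0n an]]; have [Nw|nNw] := pselect (N w); [by right|left].
  have pK : forall n, p n w < K by apply: contrapT => h; apply/nNw/NK.
  exists (n - n0)%N; rewrite /Y (subnKC n0n) ler_pdivrMr // mulrAC ler_pdivlMr //.
  apply: ler_pM => //; exact: ltW.
apply: (@le_trans _ _ (K%:E * ((a / K)%:E * P E'))%E); last first.
  by rewrite lee_pmul2l ?lte_fin.
rewrite muleA -EFinM (mulrC K) divfK ?gt_eqF //.
by rewrite lee_pmul2l ?lte_fin.
Qed.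

End fejer.

(** * Almost sure limits and Fatou's lemma *)

Section limits.
Import numFieldNormedType.Exports.
Context {dT : measure_display} {T : measurableType dT} {R : realType}.
Variable P : probability T R.

Lemma measurable_fun_patch (C : set T) (f g : T -> R) : measurable C ->
  measurable_fun setT f -> measurable_fun setT g ->
  measurable_fun setT (fun w => \1_C w * f w + \1_(~` C) w * g w).
Proof.
move=> mC mf mg; apply: measurable_funD; apply: measurable_funM => //;
  apply: measurable_indic => //; exact: measurableC.
Qed.

Lemma ae_fatou (f : nat -> T -> R) (g : T -> R) (c : R) :
  (forall n w, 0 <= f n w) -> (forall n, measurable_fun setT (f n)) ->
  (forall w, 0 <= g w) -> measurable_fun setT g ->
  {ae P, forall w, (fun n => f n w) @ \oo --> g w} ->
  (forall n, (\int[P]_w (f n w)%:E <= c%:E)%E) -> (\int[P]_w (g w)%:E <= c%:E)%E.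
Proof.
move=> f0 mf g0 mg [N [mN PN0 Nfg]] fc.
(* Replacing the sequence by its target on the exceptional null set gives convergence everywhere
   without changing the bounds on the integrals. *)
pose f' n w := \1_N w * g w + \1_(~` N) w * f n w.
have f'N n w : N w -> f' n w = g w.
  by move=> Nw; rewrite /f' !indicE mem_set // memNset ?mul0r ?addr0 ?mul1r //; exact.
have f'nN n w : ~ N w -> f' n w = f n w.
  by move=> Nw; rewrite /f' !indicE memNset // mem_set // mul0r add0r mul1r.
have f'0 n w : 0 <= f' n w by rewrite /f' !indicE addr_ge0 // mulr_ge0.
have mf' n : measurable_fun setT (f' n) by exact: measurable_fun_patch.
have f'c n : (\int[P]_w (f' n w)%:E <= c%:E)%E.
  apply: le_trans (fc n); apply: ae_ge0_le_integral => //.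
  - by move=> w _; rewrite lee_fin.
  - exact/measurable_EFinP.
  - by move=> w _; rewrite lee_fin.
  - exact/measurable_EFinP.
  exists N; split=> // w /= h; apply: contrapT => /f'nN fE.
  by apply: h => _; rewrite fE.
have f'g w : limn_einf (fun n => (f' n w)%:E) = (g w)%:E.
  apply: (cvg_limn_einf_sup _).1; apply/cvg_EFin; first exact: nearW.
  have [Nw|nNw] := pselect (N w).
    rewrite (_ : _ \o _ = cst (g w)); first exact: cvg_cst.
    by apply/funext => n /=; rewrite f'N.
  rewrite (_ : _ \o _ = fun n => f n w); first by apply: contrapT => /Nfg.
  by apply/funext => n /=; rewrite f'nN.
have -> : (\int[P]_w (g w)%:E = \int[P]_w limn_einf (fun n => (f' n w)%:E))%E.
  by apply: eq_integral => w _; rewrite f'g.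
apply: (le_trans (fatou P measurableT (f := fun n w => (f' n w)%:E) _ _)).
- by move=> n; exact/measurable_EFinP.
- by move=> n w _; rewrite lee_fin.
rewrite limn_einf_lim; apply: lime_le; first exact: is_cvg_einfs.
apply: nearW => n; apply: le_trans (f'c n).
by apply: ereal_inf_lbound; exists n => /=.
Qed.

Context {X : Type} (d : X -> X -> R).
Hypotheses (d_metric : is_metric d) (X_sep : metric_separable d)
  (X_compl : metric_complete d).
Variables (S : set X) (t : nat -> X) (x : nat -> T -> X).
Hypotheses (S_closed : dclosed d S) (St : forall k, S (t k)).
Hypothesis mx : forall n, dmeas_wrt d measurable (x n).

(** The centre [t k] may depend on [w]. Quantifying over countably many centres and indices keeps
    the event measurable, and a random point [t (kap w)] provides the witness. *)
Definition eventually_near (e : R) : set T :=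
  [set w | exists k N, forall n, (N <= n)%N -> d (t k) (x n w) < e].

Lemma measurable_eventually_near e : measurable (eventually_near e).
Proof.
rewrite (_ : eventually_near e = \bigcup_k \bigcup_N
    \bigcap_(n in [set n | (N <= n)%N]) [set w | d (t k) (x n w) < e]).
  apply: bigcupT_measurable => k; apply: bigcupT_measurable => N.
  apply: bigcap_measurableType => n _; apply: measurable_lt_set => //.
  exact: measurable_dist_cst.
apply/seteqP; split=> [w [k [N h]]|w [k _ [N _ h]]].
  by exists k => //; exists N.
by exists k, N.
Qed.

(* Staying eventually near points of [S] at every scale forces the sequence to be
   Cauchy and its limit to be adherent to [S]. *)
Lemma eventually_near_limit w : (forall m : nat, eventually_near m.+1%:R^-1 w) ->
  exists l, S l /\
    forall e : R, 0 < e -> exists N, forall n, (N <= n)%N -> d (x n w) l < e.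
Proof.
have [_ _ dsym dtri] := d_metric.
move=> near.
have near_e (e : R) : 0 < e ->
    exists k N, forall n, (N <= n)%N -> d (t k) (x n w) < e.
  move=> /invS_lt[m me]; have [k [N h]] := near m; exists k, N => n Nn.
  exact: lt_trans (h n Nn) me.
have [l ll] : exists l, forall e : R, 0 < e ->
    exists N, forall n, (N <= n)%N -> d (x n w) l < e.
  apply: (X_compl (fun n => x n w)) => e e0.
  have [|k [N h]] := near_e (e / 2); first by rewrite divr_gt0.
  exists N => m n Nm Nn.
  have := dtri (x m w) (t k) (x n w); rewrite (dsym (x m w) (t k)).
  by have := h _ Nm; have := h _ Nn; lra.
exists l; split=> //; apply: contrapT => nSl.
have [e e0 eS] := S_closed l nSl.
have [|k [N h]] := near_e (e / 2); first by rewrite divr_gt0.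
have [|N' h'] := ll (e / 2); first by rewrite divr_gt0.
have := h _ (leq_maxl N N'); have := h' _ (leq_maxr N N').
set n := maxn N N' => h1 h2.
apply: (eS (t k)); last exact: St.
have := dtri l (x n w) (t k); rewrite (dsym l (x n w)) (dsym (x n w) (t k)).
by rewrite /dball /=; lra.
Qed.

Lemma ae_limit : (forall e : R, 0 < e -> P (~` eventually_near e) = 0%E) ->
  exists xl : T -> X, [/\ dmeas_wrt d measurable xl, forall w, S (xl w) &
    {ae P, forall w, (fun n => d (x n w) (xl w)) @ \oo --> 0}].
Proof.
have [d0 _ dsym dtri] := d_metric.
move=> near0.
pose C := \bigcap_(m : nat) eventually_near m.+1%:R^-1.
have mC : measurable C.
  by apply: bigcap_measurableType => m _; exact: measurable_eventually_near.
have PC0 : P (~` C) = 0%E.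
  apply/negligibleP; first exact: measurableC.
  rewrite /C setC_bigcap; apply: negligible_bigcup => m.
  apply/negligibleP; first exact/measurableC/measurable_eventually_near.
  by apply: near0; rewrite invr_gt0.
(* The default [t 0] off [C] keeps the limit in [S] everywhere and makes it measurable. *)
have /choice[xl xlP] : forall w, exists l, [/\ S l,
    C w -> forall e : R, 0 < e -> exists N, forall n, (N <= n)%N -> d (x n w) l < e &
    ~ C w -> l = t 0].
  move=> w; have [Cw|nCw] := pselect (C w); last by exists (t 0); split.
  by have [|l [Sl ll]] := eventually_near_limit w; [move=> m; exact: Cw|exists l; split].
exists xl; split; last 1 first.
- exists (~` C); split=> //; first exact: measurableC.
  move=> w h Cw; apply: h; apply/cvgrPdist_lt => e e0.
  have [_ /(_ Cw e e0)[N hN] _] := xlP w.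
  exists N => // n /= Nn; rewrite sub0r normrN ger0_norm //; exact: hN.
- apply: dmeas_of_dist => // s.
  (* Distances to a fixed point, patched in the same way off [C], converge at every [w]. *)
  apply: (@measurable_fun_cvg _ _ _ setT
    (fun n w => \1_C w * d s (x n w) + \1_(~` C) w * d s (t 0))).
    move=> n; apply: measurable_fun_patch => //; exact: measurable_dist_cst.
  move=> w _; have [_ xlC xlnC] := xlP w.
  have [Cw|nCw] := pselect (C w); last first.
    rewrite xlnC // (_ : (fun n => _) = cst (d s (t 0))); first exact: cvg_cst.
    by apply/funext => n; rewrite !indicE memNset // mem_set // mul0r add0r mul1r.
  rewrite (_ : (fun n => _) = fun n => d s (x n w)); last first.
    by apply/funext => n; rewrite !indicE mem_set // memNset ?mul0r ?addr0 ?mul1r //.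
  apply/cvgrPdist_lt => e e0; have [N hN] := xlC Cw e e0.
  exists N => // n /= Nn; have := hN n Nn.
  rewrite ltr_distlC.
  have := dtri s (xl w) (x n w); have := dtri s (x n w) (xl w).
  by rewrite (dsym (xl w) (x n w)); lra.
by move=> w; have [] := xlP w.
Qed.

End limits.

(** * Series tails, and the two rates *)

Lemma nneseries_tail_le {R : realType} (u : nat -> \bar R) (m n : nat) :
  (m <= n)%N -> (forall k, (0 <= u k)%E) ->
  (\sum_(n <= k <oo) u k <= \sum_(m <= k <oo) u k)%E.
Proof.
move=> mn u0; rewrite [X in (_ <= X)%E](nneseries_split m (n - m)) // subnKC //.
by apply: leeDr; exact: sume_ge0.
Qed.

Lemma nneseries_term_le {R : realType} (u : nat -> \bar R) (m n : nat) :
  (m <= n)%N -> (forall k, (0 <= u k)%E) -> (u n <= \sum_(m <= k <oo) u k)%E.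
Proof.
move=> mn u0; apply: le_trans (nneseries_tail_le u m n mn u0).
apply: le_trans (nneseries_lim_ge n.+1 _) => //.
by rewrite big_nat1.
Qed.

(** If it failed with d(y, z) > 0, consistency at epsilon = d(y, z) would give d(y, z) < d(y, z);
    distance 0 is covered by theta(0) = 0. *)
Lemma modulus_le {R : realType} {X : Type} (d phi : X -> X -> R) (theta : R -> R) y z :
  is_metric d -> (forall y z, 0 <= phi y z) -> theta 0 = 0 ->
  unif_consistent d phi theta -> theta (d y z) <= phi y z.
Proof.
move=> [d0 _ _ _] phi0 theta0 cons.
have := d0 y z; rewrite le_eqVlt => /predU1P[<-|dpos]; first by rewrite theta0.
by rewrite leNgt; apply/negP => /(cons _ _ _ dpos); rewrite ltxx.
Qed.

Theorem theorem4p8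
  (R : realType) (X : Type) (d : X -> X -> R)
  (d_metric : is_metric d) (X_sep : metric_separable d) (X_compl : metric_complete d)
  (dO : measure_display) (Omega : measurableType dO) (P : probability Omega R)
  (Fn : nat -> set (set Omega)) (Fn_filt : filtration Fn)
  (F : X -> \bar R) (F_ge0 : forall z, (0 <= F z)%E)
  (F_meas : emeas_wrt (dborel d) F)
  (zerF_closed : dclosed d (zer F))
  (zerF_nonempty : (zer F) !=set0)
  (phi : X -> X -> R) (phi_car : caratheodory d phi)
  (theta : R -> R)
  (theta_ndecr : forall a b : R, 0 <= a -> a <= b -> theta a <= theta b)
  (theta_convex : forall a b t : R, 0 <= a -> 0 <= b -> 0 <= t <= 1 ->
      theta (t * a + (1 - t) * b) <= t * theta a + (1 - t) * theta b)
  (theta0 : theta 0 = 0) (theta_pos : forall e : R, 0 < e -> 0 < theta e)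
  (phi_cons : unif_consistent d phi theta)
  (x : nat -> Omega -> X) (x_adapted : forall n, dmeas_wrt d (Fn n) (x n))
  (zeta xi : nat -> Omega -> R)
  (zeta_l1 : ell1_plus P Fn zeta) (xi_l1 : ell1_plus P Fn xi)
  (x_fejer : strong_stoch_qfejer d P phi (zer F) Fn x zeta xi)
  (K : R) (K_pos : 0 < K)
  (K_bound : {ae P, forall w,
      limn (fun N => (\prod_(i < N) (1 + zeta i w))%:E) < K%:E}%E)
  (chi : R -> nat)
  (chi_rate : forall e : R, 0 < e ->
      (\sum_(chi e <= k <oo) \int[P]_w (xi k w)%:E < e%:E)%E)
  (varphi : R -> nat -> R)
  (varphi_pos : forall (e : R) (N : nat), 0 < e -> 0 < varphi e N)
  (varphi_liminf : forall (e : R) (N : nat), 0 < e ->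
      exists n : nat, (N <= n)%N /\ n%:R <= varphi e N /\
        (\int[P]_w F (x n w) < e%:E)%E)
  (D : set (Omega -> X)) (D_rv : forall y, D y -> dmeas_wrt d measurable y)
  (x_in_D : forall n, D (x n))
  (tau : R -> R) (tau_pos : forall e : R, 0 < e -> 0 < tau e)
  (tau_reg : forall (e : R) (y : Omega -> X), 0 < e -> D y ->
      (\int[P]_w F (y w) < (tau e)%:E)%E ->
      (\int[P]_w distphi phi (zer F) (y w) < e%:E)%E) :
  let rho := fun e : R => varphi (tau (e / (3 * K))) (chi (e / (3 * K))) in
  exists xl : Omega -> X,
    [/\ dmeas_wrt d measurable xl /\ (forall w, zer F (xl w)),
        ((fun n => \int[P]_w (d (x n w) (xl w))%:E) @ \oo --> 0)%E,
        {ae P, forall w, (fun n => d (x n w) (xl w)) @ \oo --> 0},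
        (forall (e : R) (n : nat), 0 < e -> rho (theta (e / 2)) <= n%:R ->
            (\int[P]_w (d (x n w) (xl w))%:E < e%:E)%E) &
        (forall lam e : R, 0 < lam -> 0 < e ->
            (P [set w | exists n : nat, (rho (lam * theta (e / 2)) <= n%:R)%R /\
                                        (e <= d (x n w) (xl w))%R] < lam%:E)%E)].
Proof.
move=> rho.
have [d0 _ dsym dtri] := d_metric.
have [phi0 [phic phim]] := phi_car.
have [sFn [subFn incFn]] := Fn_filt.
have [xi0 _] := xi_l1.
have [t [St t_dense]] := dense_in_subset d d_metric _ X_sep zerF_nonempty.
have mx n : dmeas_wrt d measurable (x n) by move=> B /x_adapted /subFn.
have int_xi0 k : (0 <= \int[P]_w (xi k w)%:E)%E.
  by apply: integral_ge0 => w _; rewrite lee_fin.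
(* What one scale [e] provides: a starting index below [rho e] and a random point controlling the
   whole tail, in mean and in probability. Everything after this uses the quasi-Fejer property only
   through it. *)
have tail e : 0 < e -> exists n0 kap, [/\ n0%:R <= rho e,
    forall k, measurable [set w | kap w = k],
    forall a, measurable [set w | exists n, (n0 <= n)%N /\ a <= phi (t (kap w)) (x n w)],
    forall n, (n0 <= n)%N -> (\int[P]_w (phi (t (kap w)) (x n w))%:E < e%:E)%E &
    forall a, 0 < a -> (a%:E * P [set w | exists n, (n0 <= n)%N /\
      (a <= phi (t (kap w)) (x n w))%R] < e%:E)%E].
  move=> e0; set del := e / (3 * K).
  have del0 : 0 < del by rewrite divr_gt0 // mulr_gt0.
  have [n0 [chin0 [n0rho Fn0]]] := varphi_liminf (tau del) (chi del) (tau_pos _ del0).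
  have dist_lt := tau_reg _ _ del0 (x_in_D n0) Fn0.
  have [kap [Fkap Phi_lt]] := near_minimiser d phi phi_car _ t St t_dense P
    (Fn n0) (sFn n0) (subFn n0) (x n0) del (x_adapted n0) dist_lt.
  have Phi_fin : (\int[P]_w (phi (t (kap w)) (x n0 w))%:E < +oo)%E.
    by apply: lt_trans Phi_lt _; exact: ltry.
  have xi_lt : (\sum_(n0 <= k <oo) \int[P]_w (xi k w)%:E < del%:E)%E.
    by apply: le_lt_trans (chi_rate _ del0); exact: nneseries_tail_le.
  have xi_fin n : (n0 <= n)%N -> (\int[P]_w (xi n w)%:E < +oo)%E.
    move=> n0n; apply: le_lt_trans (lt_trans xi_lt (ltry _)).
    by apply: (nneseries_term_le (fun k => \int[P]_w (xi k w)%:E)%E).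
  have KB : (K%:E * (\int[P]_w (phi (t (kap w)) (x n0 w))%:E +
      \sum_(n0 <= k <oo) \int[P]_w (xi k w)%:E) < e%:E)%E.
    rewrite (_ : e%:E = K%:E * (e / K)%:E)%E; last first.
      by rewrite -EFinM mulrC divfK // gt_eqF.
    rewrite lte_pmul2l ?lte_fin //; apply: (lt_trans (lteD Phi_lt xi_lt)).
    rewrite -EFinD lte_fin /del invfM (mulrC 3^-1) mulrA.
    have : 0 < e / K by rewrite divr_gt0.
    by lra.
  exists n0, kap; split=> //.
  - by move=> k; exact: subFn (Fkap k).
  - exact: (measurable_fejer_event d Fn Fn_filt phi phi_car x x_adapted t n0 kap Fkap).
  - move=> n n0n; apply: le_lt_trans KB.
    exact: (fejer_mean d P Fn Fn_filt phi (zer F) phi_car x x_adapted zeta xi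
      zeta_l1 xi_l1 x_fejer K K_bound t n0 kap St Fkap Phi_fin xi_fin).
  - move=> a a0; apply: le_lt_trans KB.
    exact: (fejer_maximal d P Fn Fn_filt phi (zer F) phi_car x x_adapted zeta xi
      zeta_l1 xi_l1 x_fejer K K_bound t n0 kap St Fkap Phi_fin xi_fin).
have near0 e : 0 < e -> P (~` eventually_near d t x e) = 0%E.
  move=> e0; apply/eqP; rewrite eq_le measure_ge0 andbT; apply/lee_addgt0Pr => r r0.
  have th0 := theta_pos _ e0; rewrite add0e.
  (* At scale theta(e) r, the maximal inequality at level theta(e) leaves probability below r. *)
  have [n0 [kap [_ _ mE _ maxE]]] := tail _ (mulr_gt0 th0 r0).
  rewrite -(lee_pmul2l (x := (theta e)%:E)) ?lte_fin //.
  apply: le_trans (ltW (maxE _ th0)); rewrite lee_pmul2l ?lte_fin //.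
  apply: le_measure; rewrite ?inE //.
    exact/measurableC/measurable_eventually_near.
  move=> w far; apply: contrapT => low; apply: far; exists (kap w), n0 => n n0n.
  by apply: phi_cons => //; rewrite ltNge; apply/negP => h; apply: low; exists n.
have [xl [mxl Sxl xl_lim]] := ae_limit P d d_metric X_sep X_compl (zer F) t x
  zerF_closed St mx near0.
have mz (kap : Omega -> nat) : (forall k, measurable [set w | kap w = k]) ->
    dmeas_wrt d measurable (fun w => t (kap w)).
  by move=> mk B _; exact: measurable_preimage_choice.
have lim_near w : (fun n => d (x n w) (xl w)) @ \oo --> 0 ->
    forall (e : R), 0 < e -> exists N, forall n, (N <= n)%N -> d (x n w) (xl w) < e.
  move=> /cvgrPdist_lt h e e0; have [N _ hN] := h e e0.
  by exists N => n Nn; have := hN n Nn; rewrite /= sub0r normrN ger0_norm.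
have mean_rate (e : R) (n : nat) : 0 < e -> rho (theta (e / 2)) <= n%:R ->
    (\int[P]_w (d (x n w) (xl w))%:E < e%:E)%E.
  move=> e0 rn; have e20 : 0 < e / 2 by rewrite divr_gt0.
  have [n0 [kap [n0r mk _ meanE _]]] := tail _ (theta_pos _ e20).
  have mzx m : measurable_fun setT (fun w => d (t (kap w)) (x m w)).
    by apply: measurable_dist => //; exact: mz.
  have mzxl : measurable_fun setT (fun w => d (t (kap w)) (xl w)).
    by apply: measurable_dist => //; exact: mz.
  have near_z m : (n0 <= m)%N -> (\int[P]_w (d (t (kap w)) (x m w))%:E < (e / 2)%:E)%E.
    move=> n0m; apply: (mean_lt_of_modulus theta theta_convex theta0 theta_pos P _
      (fun w => phi (t (kap w)) (x m w))) => //.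
    - apply: (measurable_fun_choice kap (fun k w => phi (t k) (x m w))) => // k.
      move=> _ B mB; rewrite setTI; apply: (mx m (phi (t k) @^-1` B)); exact: phim.
    - by move=> w; exact: (modulus_le d phi theta).
    - exact: meanE.
  have lim_z : (\int[P]_w (d (t (kap w)) (xl w))%:E <= (e / 2)%:E)%E.
    apply: (ae_fatou P (fun m w => d (t (kap w)) (x (n0 + m)%N w))) => //.
    - apply: filterS xl_lim => w /lim_near lw; apply/cvgrPdist_lt => r r0.
      have [N hN] := lw r r0; exists N => // m /= Nm.
      have := hN (n0 + m)%N (leq_trans Nm (leq_addl _ _)).
      rewrite ltr_distlC.
      have := dtri (t (kap w)) (xl w) (x (n0 + m)%N w).
      have := dtri (t (kap w)) (x (n0 + m)%N w) (xl w).
      by rewrite (dsym (xl w) (x (n0 + m)%N w)); lra.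
    - by move=> m; apply/ltW/near_z; exact: leq_addr.
  have n0n : (n0 <= n)%N by rewrite -(ler_nat R) (le_trans n0r).
  apply: (@le_lt_trans _ _ (\int[P]_w (d (t (kap w)) (x n w) + d (t (kap w)) (xl w))%:E)%E).
    apply: ge0_le_integral_EFin => //; first exact: measurable_dist.
    - exact: measurable_funD.
    - by move=> w _; rewrite (dsym (t _) (x n w)).
  rewrite ge0_integralD_EFin // (_ : e%:E = (e / 2)%:E + (e / 2)%:E)%E; last first.
    by rewrite -EFinD -splitr.
  (* Fatou gives only <= e/2 for the limit, so the strict inequality comes from [x n]. *)
  apply: lte_leD => //; last exact: near_z.
  rewrite ge0_fin_numE; first by apply: le_lt_trans lim_z _; exact: ltry.
  by apply: integral_ge0 => w _; rewrite lee_fin.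
exists xl; split=> //.
- apply/fine_cvgP; split.
    (* The rate at accuracy 1 makes the means finite from some index on, as convergence in the
       extended reals demands. *)
    have [N hN] : exists N : nat, rho (theta (1 / 2)) <= N%:R.
      by exists (Num.truncn (rho (theta (1 / 2)))).+1; exact/ltW/truncnS_gt.
    exists N => // n /= Nn; rewrite ge0_fin_numE; last first.
      by apply: integral_ge0 => w _; rewrite lee_fin.
    apply: lt_trans (mean_rate 1 n _ _) (ltry _) => //.
    by apply: (le_trans hN); rewrite ler_nat.
  apply/cvgrPdist_lt => e e0.
  have [N hN] : exists N : nat, rho (theta (e / 2)) <= N%:R.
    by exists (Num.truncn (rho (theta (e / 2)))).+1; exact/ltW/truncnS_gt.
  exists N => // n /= Nn.
  have ie : (\int[P]_w (d (x n w) (xl w))%:E < e%:E)%E.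
    by apply: mean_rate => //; apply: (le_trans hN); rewrite ler_nat.
  have i0 : (0 <= \int[P]_w (d (x n w) (xl w))%:E)%E.
    by apply: integral_ge0 => w _; rewrite lee_fin.
  rewrite sub0r normrN ger0_norm ?fine_ge0 // -lte_fin fineK //.
  by rewrite ge0_fin_numE // (lt_trans ie) // ltry.
- move=> lam e lam0 e0; have e20 : 0 < e / 2 by rewrite divr_gt0.
  have th0 := theta_pos _ e20.
  (* The factor [lam] in the scale becomes the probability once the level theta(e/2) is
     cancelled. *)
  have [n0 [kap [n0r mk mE _ maxE]]] := tail _ (mulr_gt0 lam0 th0).
  have PE := maxE _ th0; rewrite (mulrC lam) EFinM lte_pmul2l ?lte_fin // in PE.
  apply: le_lt_trans PE.
  have [N [mN PN0 NK]] := xl_lim.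
  set E1 := (X in (_ <= P X)%E).
  have : (P (E1 `|` N) <= P E1)%E.
    rewrite -[X in (_ <= X)%E]adde0 -[in X in (_ <= X)%E]PN0.
    by apply: measureU2 => //; exact: mE.
  apply: le_trans; apply: le_measure; rewrite ?inE.
  - rewrite (_ : [set w | _] = \bigcup_(n in [set n : nat | rho (lam * theta (e / 2)) <= n%:R])
        [set w | e <= d (x n w) (xl w)]).
      apply: bigcup_measurable => n _; apply: measurable_le_set => //.
      exact: measurable_dist.
    by apply/seteqP; split=> [w [n [h1 h2]]|w [n h1 h2]]; exists n.
  - by apply: measurableU => //; exact: mE.
  move=> w [n [rn en]]; have [Nw|nNw] := pselect (N w); [by right|left].
  have n0n : (n0 <= n)%N by rewrite -(ler_nat R) (le_trans n0r).
  apply: contrapT => low.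
  have close m : (n0 <= m)%N -> d (t (kap w)) (x m w) < e / 2.
    move=> n0m; apply: phi_cons => //; rewrite ltNge; apply/negP => h.
    by apply: low; exists m.
  have /lim_near lw : (fun n => d (x n w) (xl w)) @ \oo --> 0.
    by apply: contrapT => /NK.
  (* If the limit were further than e/2 from z, an [x m] closer to the limit than the excess would
     contradict [close]. *)
  have zl : d (t (kap w)) (xl w) <= e / 2.
    rewrite leNgt; apply/negP => far.
    have gap0 : 0 < d (t (kap w)) (xl w) - e / 2 by rewrite subr_gt0.
    have [M hM] := lw _ gap0.
    have := hM _ (leq_maxl M n0); have := close _ (leq_maxr M n0).
    by have := dtri (t (kap w)) (x (maxn M n0) w) (xl w); lra.
  have := dtri (x n w) (t (kap w)) (xl w); rewrite (dsym (x n w) (t _)).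
  by have := close n n0n; lra.
Qed.
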